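(* Let $U$ be a unitary reflection of size $(d+1)\times(d+1)$ all of whose first-column entries $U_{i0}$, $0\le i\le d$, are nonzero, let $\delta=\mathrm{diag}(U_{00},\dots,U_{d0})$, let $D$ be a diagonal matrix with positive diagonal entries and $D_{00}=1$, and let $A=\delta^{-1}U\sqrt D$. Let $N\ge 0$ and let $\Phi=(\bar A)^*$ be the Krawtchouk matrix in degree $N$. Then: 1. (Involutive property) $\left(\overline{\delta^*D^{-1/2}}\;\Phi\right)^2=I$. 2. (Self-adjointness) $\Phi\,B\,(\bar\delta)^*\,\overline{D^{1/2}}$ is self-adjoint.
   Context: Matrices have complex entries with rows and columns indexed by $0,1,\dots,d$; $A^*$ is the Hermitian transpose. A unitary reflection is a matrix of the form $U=2\,\mathbf v\mathbf v^*/(\mathbf v^*\mathbf v)-I$ for a nonzero vector $\mathbf v$; it is both self-adjoint and unitary, so $U^2=I$. Multi-indices are tuples $n=(n_0,\dots,n_d)$ of nonnegative integers, $|n|=\sum_i n_i$, $x^n=x_0^{n_0}\cdots x_d^{n_d}$. For an integer $N\ge 0$, the symmetric power $\bar A$ of a matrix $A$ in degree $N$ is the matrix indexed by multi-indices $m,n$ with $|m|=|n|=N$ defined by $(Ax)^m=\sum_{|n|=N}\bar A_{mn}x^n$, where $(Ax)_i=\sum_j A_{ij}x_j$. The bar always denotes this symmetric power map in degree $N$ (never complex conjugation). $B$ is the diagonal matrix indexed by multi-indices of total degree $N$ with $B_{mm}=\frac{N!}{m_0!\cdots m_d!}$. $I$ is the identity matrix of the appropriate size. *)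

(* Defs.v *)
From HB Require Import structures.
From mathcomp Require Import all_boot all_order all_algebra.
From mathcomp Require Import sesquilinear spectral.
From mathcomp Require Import reals complex mpoly.

Set Implicit Arguments.
Unset Strict Implicit.
Unset Printing Implicit Defensive.

Import Order.TTheory GRing.Theory Num.Theory.

Local Open Scope ring_scope.
Local Open Scope sesquilinear_scope.

(* The finite type of multi-indices n = (n_0, ..., n_d) with |n| = N. *)
Definition multi_index (d N : nat) : finType :=
  {n : 'X_{1..d.+1 < N.+1} | mdeg n == N}.

Definition multi_index_mnm (d N : nat) (n : multi_index d N) : 'X_{1..d.+1} :=
  bmnm (val n).

(* Library matrices are indexed by ordinals, so matrices indexed by
   multi-indices are obtained by numbering the latter with enum_val. *)
Definition midx (d N : nat) (k : 'I_#|multi_index d N|) : 'X_{1..d.+1} :=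
  multi_index_mnm (enum_val k).

Section Krawtchouk.

Variable C : numClosedFieldType.

Definition linform (d : nat) (A : 'M[C]_d.+1) (i : 'I_d.+1) : {mpoly C[d.+1]} :=
  \sum_(j < d.+1) A i j *: 'X_j.

(* The symmetric power of A in degree N: its (m, n) entry is the coefficient
   of x^n in (A x)^m; see sympowP for the defining identity. *)
Definition sympow (d N : nat) (A : 'M[C]_d.+1) : 'M[C]_#|multi_index d N| :=
  \matrix_(k, l) (\prod_(i < d.+1) linform A i ^+ (midx k i))@_(midx l).

Definition multinom_mx (d N : nat) : 'M[C]_#|multi_index d N| :=
  diag_mx (\row_k (N`!%:R / \prod_(i < d.+1) (midx k i)`!%:R)).

Definition unitary_reflection (n : nat) (U : 'M[C]_n) : Prop :=
  exists2 v : 'cV[C]_n,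
    v != 0 & U = (2 / (v ^t* *m v) 0 0) *: (v *m v ^t*) - 1%:M.

(* The square root of a diagonal matrix with positive diagonal entries. *)
Definition sqrt_diag (n : nat) (D : 'M[C]_n) : 'M[C]_n :=
  diag_mx (\row_i sqrtC (D i i)).

Definition first_col_diag (d : nat) (U : 'M[C]_d.+1) : 'M[C]_d.+1 :=
  diag_mx (\row_i U i 0).

Definition krawtchouk (d N : nat) (A : 'M[C]_d.+1) : 'M[C]_#|multi_index d N| :=
  (sympow N A) ^t*.

Lemma mdeg_midx d N (k : 'I_#|multi_index d N|) : mdeg (midx k) = N.
Proof. exact/eqP/(valP (enum_val k)). Qed.

Lemma midx_inj d N : injective (@midx d N).
Proof. by move=> k l /val_inj /val_inj /enum_val_inj. Qed.

Lemma midx_surj d N (n : 'X_{1..d.+1}) :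
  mdeg n = N -> exists k : 'I_#|multi_index d N|, midx k = n.
Proof.
move=> nN; have ltnN : (mdeg n < N.+1)%N by rewrite nN.
have nN' : mdeg (BMultinom ltnN) == N by apply/eqP.
exists (enum_rank (Sub (BMultinom ltnN) nN' : multi_index d N)).
by rewrite /midx enum_rankK.
Qed.

Lemma sympowP d N (A : 'M[C]_d.+1) (k : 'I_#|multi_index d N|) :
  \prod_(i < d.+1) linform A i ^+ (midx k i)
    = \sum_l sympow N A k l *: 'X_[midx l].
Proof.
have hom : \prod_(i < d.+1) linform A i ^+ (midx k i) \is N.-homog.
  have hpow i e : linform A i ^+ e \is e.-homog.
    rewrite -[X in X.-homog]mul1n; apply: dhomogMn.
    by apply: rpred_sum => j _; apply: rpredZ; rewrite dhomogX /= mdeg1.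
  suff: \prod_(i < d.+1) linform A i ^+ (midx k i)
          \is (\sum_(i < d.+1) midx k i)%N.-homog.
    by rewrite -mdegE mdeg_midx.
  by elim/big_ind2: _ => [|? ? ? ?|]; rewrite ?dhomog1 //; apply: dhomogM.
apply/mpolyP => n; rewrite (linear_sum (mcoeff n)) /=.
transitivity (\sum_(l : 'I_#|multi_index d N|)
  (\prod_(i < d.+1) linform A i ^+ (midx k i))@_(midx l) * (midx l == n)%:R);
  last by apply: eq_bigr => l _; rewrite mcoeffZ mcoeffX mxE.
case: (eqVneq (mdeg n) N) => [nN|nN].
  have [l <-] := midx_surj nN.
  rewrite [RHS](bigD1 l) //= eqxx mulr1 [X in _ + X]big1 ?addr0 // => j neq.
  by rewrite (inj_eq (@midx_inj d N)) (negPf neq) mulr0.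
rewrite (dhomog_nemf_coeff hom nN) [RHS]big1 // => l _.
by case: eqP => [E|_]; [rewrite -E mdeg_midx eqxx in nN | rewrite mulr0].
Qed.

End Krawtchouk.

(* Main.v *)
From HB Require Import structures.
Require Import Defs.
From mathcomp Require Import all_boot all_order all_algebra.
From mathcomp Require Import sesquilinear spectral.
From mathcomp Require Import reals complex mpoly.

Import Order.TTheory GRing.Theory Num.Theory.

Local Open Scope ring_scope.
Local Open Scope sesquilinear_scope.

(** Two facts about the symmetric power carry the proof.  It is multiplicative,
because the m-th row of sympow N A lists the coefficients of the image of x^m
under the substitution x := A x, and substitutions compose ([sympowM]).  And it
exchanges transposition with conjugation by the multinomial weights,
B (sympow N A) = (sympow N A^T)^T B ([multinom_mx_sympow]), so that
Phi B = B (sympow N A^* ) for the Krawtchouk matrix Phi of A.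

The second fact is the reciprocity n! [x^n] (A x)^m = m! [x^m] (A^T x)^n.  It
expresses that substituting A and substituting A^T are adjoint for the pairing
of polynomials in which the monomials are orthogonal with (x^n, x^n) = n!.  For
this pairing multiplication by x_j is adjoint to the derivation in x_j, so the
chain rule d_j (p(A x)) = sum_i A_ij (d_i p)(A x) gives the reciprocity by
induction on |n| ([linsubst_reciprocity]).

Write S for the square root of D.  Since delta and S are diagonal and S is real,
the matrices of both assertions collapse.  The prefactor in the first one is
itself the Krawtchouk matrix of S^-1 delta, hence its product with Phi is the
Krawtchouk matrix of A S^-1 delta = delta^-1 U delta, which squares to 1 because
U does.  In the second one, the matrix equals B (sympow N H) with
H = (delta A)^* S = S U S, and B (sympow N H) is Hermitian as soon as H is. *)

(** * Symmetric powers as linear substitutions *)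

Section SymmetricPower.

Variables (C : numClosedFieldType) (d : nat).

Implicit Types (A B : 'M[C]_d.+1) (p : {mpoly C[d.+1]}) (m n : 'X_{1..d.+1}).

(** The action p(x) |-> p(A x); row m of [sympow N A] is its value at x^m. *)
Definition linsubst A p : {mpoly C[d.+1]} :=
  p \mPo [tuple linform A i | i < d.+1].

HB.instance Definition _ A := GRing.LRMorphism.copy (linsubst A)
  (comp_mpoly [tuple linform A i | i < d.+1]).

Lemma linsubstX A m :
  linsubst A 'X_[m] = \prod_(i < d.+1) linform A i ^+ m i.
Proof.
by rewrite /linsubst comp_mpolyX; apply: eq_bigr => i _; rewrite tnth_mktuple.
Qed.

Lemma linsubstU A i : linsubst A 'X_i = linform A i.
Proof. by rewrite /linsubst comp_mpolyXU -tnth_nth tnth_mktuple. Qed.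

Lemma sympowE N A k l :
  sympow N A k l = (linsubst A 'X_[midx k])@_(midx l).
Proof. by rewrite mxE linsubstX. Qed.

(** Substitution acts on the right: first A, then B, is A *m B, because the
variables of A x are themselves replaced by B x. *)
Lemma linsubst_linform A B i : linsubst B (linform A i) = linform (A *m B) i.
Proof.
rewrite /linform linear_sum /=.
under eq_bigr => j _.
  rewrite linearZ /= linsubstU /linform scaler_sumr; over.
rewrite exchange_big /=; apply: eq_bigr => k _.
by rewrite mxE scaler_suml; apply: eq_bigr => j _; rewrite scalerA.
Qed.

Lemma linsubst_mul A B m :
  linsubst (A *m B) 'X_[m] = linsubst B (linsubst A 'X_[m]).
Proof.
rewrite !linsubstX rmorph_prod; apply: eq_bigr => i _ /=.
by rewrite rmorphXn /= linsubst_linform.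
Qed.

Lemma sympowM N A B : sympow N (A *m B) = sympow N A *m sympow N B.
Proof.
apply/matrixP => k l; rewrite sympowE linsubst_mul mxE.
rewrite (linsubstX A) sympowP (linear_sum (linsubst B)) (linear_sum (mcoeff (midx l))) /=.
apply: eq_bigr => j _.
by rewrite linearZ /= mcoeffZ -sympowE.
Qed.

Lemma sympow_diag N (a : 'rV[C]_d.+1) :
  sympow N (diag_mx a) = diag_mx (\row_k \prod_(i < d.+1) a 0 i ^+ midx k i).
Proof.
have linformE i : linform (diag_mx a) i = a 0 i *: 'X_i.
  rewrite /linform (bigD1 i) //= mxE eqxx big1 ?addr0 // => j ne_ji.
  by rewrite mxE eq_sym (negPf ne_ji) scale0r.
apply/matrixP => k l; rewrite sympowE linsubstX.
under eq_bigr do rewrite linformE exprZn.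
rewrite scaler_prod -mpolyXE_id mcoeffZ mcoeffX !mxE.
by rewrite (inj_eq (@midx_inj d N)) mulr_natr.
Qed.

Lemma sympow1 N : sympow N 1%:M = 1%:M :> 'M[C]_#|multi_index d N|.
Proof.
rewrite -diag_const_mx sympow_diag -diag_const_mx; congr diag_mx.
by apply/rowP => k; rewrite !mxE big1 // => i _; rewrite mxE expr1n.
Qed.

Lemma sympow_conj N A :
  sympow N (map_mx Num.conj A) = map_mx Num.conj (sympow N A).
Proof.
apply/matrixP => k l; rewrite !mxE -mcoeff_map_mpoly rmorph_prod /=.
congr (_@__); apply: eq_bigr => i _; rewrite rmorphXn /= /linform raddf_sum /=.
by congr (_ ^+ _); apply: eq_bigr => j _; rewrite map_mpolyZ map_mpolyX mxE.
Qed.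

(** * Reciprocity for transposed substitutions *)

(** The chain rule.  Both sides are compatible with sums and, by the Leibniz
rule, with products, so it is enough to check the variables. *)
Lemma mderiv_linsubst A j p :
  (linsubst A p)^`M(j) = \sum_(i < d.+1) A i j *: linsubst A p^`M(i).
Proof.
pose chain p := (linsubst A p)^`M(j)
  = \sum_(i < d.+1) A i j *: linsubst A p^`M(i).
have chainM q r : chain q -> chain r -> chain (q * r).
  rewrite /chain !rmorphM /= => hq hr; rewrite mderivM hq hr.
  rewrite mulr_suml mulr_sumr -big_split; apply: eq_bigr => i _ /=.
  by rewrite mderivM rmorphD !rmorphM /= scalerDr scalerAl scalerAr.
have chain1 : chain 1.
  rewrite /chain rmorph1 -mpolyC1 mderivC big1 // => i _.
  by rewrite mderivC raddf0 scaler0.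
have chainU k : chain 'X_k.
  rewrite /chain linsubstU /linform raddf_sum /=.
  have dX i1 i2 : ('X_i1 : {mpoly C[d.+1]})^`M(i2) = (i1 == i2)%:R.
    rewrite mderivX mnm1E; case: eqP => [->|_]; last by rewrite scale0r.
    by rewrite scale1r -[X in (X - _)%MM]add0m addmK mpolyX0.
  transitivity (A k j *: (1 : {mpoly C[d.+1]})).
    rewrite (bigD1 j) //= big1 ?addr0 => [|i ne_ij]; rewrite mderivZ dX ?eqxx //.
    by rewrite (negPf ne_ij) scaler0.
  rewrite [RHS](bigD1 k) //= [X in _ + X]big1 ?addr0 => [|i ne_ik]; rewrite dX.
    by rewrite eqxx rmorph1.
  by rewrite eq_sym (negPf ne_ik) raddf0 scaler0.
elim/mpolyind: p => [|c m p _ _ ih].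
  rewrite raddf0 mderiv0 big1 // => i _.
  by rewrite mderiv0 raddf0 scaler0.
have chainX : chain 'X_[m].
  rewrite mpolyXE_id; apply: (big_ind chain) => [||i _]; [exact: chain1 | exact: chainM |].
  elim: (m i) => [|e IHe]; first by rewrite expr0; exact: chain1.
  by rewrite exprS; apply: chainM; first exact: chainU.
rewrite linearP /= mderivD mderivZ chainX ih scaler_sumr -big_split; apply: eq_bigr => i _.
rewrite mderivD mderivZ linearP /=.
by rewrite scalerDr !scalerA mulrC.
Qed.

Definition mfact m : nat := \prod_(i < d.+1) (m i)`!.

Lemma mfact_neq0 m : (mfact m)%:R != 0 :> C.
Proof. by rewrite pnatr_eq0 -lt0n prodn_gt0 // => i; rewrite fact_gt0. Qed.

Lemma mfactU m i : mfact (m + U_(i))%MM = ((m i).+1 * mfact m)%N.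
Proof.
rewrite /mfact (bigD1 i) //= [in RHS](bigD1 i) //= mnmDE mnm1E eqxx addn1 factS.
rewrite -!mulnA; congr (_ * (_ * _))%N; apply: eq_bigr => j ne_ji.
by rewrite mnmDE mnm1E eq_sym (negPf ne_ji) addn0.
Qed.

Lemma mnm_neq0_exists m : m != 0%MM -> exists i, m i != 0%N.
Proof.
move=> nz_m; apply/existsP; apply: contraNT nz_m; rewrite negb_exists.
move=> /forallP mz; apply/eqP/mnmP => i; rewrite mnm0E; apply/eqP.
by rewrite -[_ == _]negbK.
Qed.

(** Linear forms have no constant term: this starts the induction below. *)
Lemma linsubst_coef0 A m : (linsubst A 'X_[m])@_0%MM = (m == 0%MM)%:R.
Proof.
have linform0 i : (linform A i)@_0%MM = 0.
  rewrite /linform (linear_sum (mcoeff _)) /= big1 // => j _.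
  by rewrite mcoeffZ mcoeffX mnm1_eq0 mulr0.
rewrite linsubstX (rmorph_prod (mcoeff 0%MM)) /=.
under eq_bigr => i _ do rewrite (rmorphXn (mcoeff 0%MM)) /= linform0 expr0n.
have [->|nz_m] := eqVneq; first by rewrite big1 // => i _; rewrite mnm0E.
have [i nz_mi] := mnm_neq0_exists _ nz_m.
by rewrite (bigD1 i) //= (negPf nz_mi) mul0r.
Qed.

(** In the pairing with (x^m, x^m) = m!, multiplication by x_i is adjoint to the
derivation in x_i: the right side pairs p with the derivative of x^m.  When
m i = 0 the truncated monomial m - U_(i) is harmless, as its coefficient is
multiplied by 0. *)
Lemma mcoeffXM_fact m i p :
  (mfact m)%:R * ('X_i * p)@_m
    = (m i * mfact (m - U_(i)))%:R * p@_(m - U_(i))%MM :> C.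
Proof.
have [mi0|mi_gt0] := posnP (m i).
  rewrite mi0 mul0n mul0r memN_msupp_eq0 ?mulr0 //.
  rewrite mulrC (perm_mem (msuppMX _ _)); apply/mapP => -[m' _ def_m].
  by move: mi0; rewrite def_m mnmDE mnm1E eqxx.
have le_Um : (U_(i) <= m)%MM by rewrite lep1mP -lt0n.
rewrite -{1 2 3}(submK le_Um) mfactU mulrC addmC [_ * p]mulrC mcoeffMX.
by rewrite mulrC mnmDE mnm1E eqxx.
Qed.

(** Adjointness of A and A^T for the pairing with (x^m, x^m) = m!.  With
n = n' + U_(j), the factor x_j of x^n becomes the derivation in x_j on the left
(chain rule) and the linear form with coefficients A i j on the right; both
leave the same combination of the instances at n' and m - U_(i). *)
Lemma linsubst_reciprocity A m n :
  (mfact n)%:R * (linsubst A 'X_[m])@_n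
    = (mfact m)%:R * (linsubst A^T 'X_[n])@_m.
Proof.
have [e le_ne] := ubnP (mdeg n); elim: e => [|e IHe] in m n le_ne *.
  by exfalso; move: le_ne; rewrite ltn0.
have [->|nz_n] := eqVneq n 0%MM.
  rewrite linsubst_coef0 mpolyX0 rmorph1 mcoeff1.
  have [->//|_] := eqVneq m 0%MM; by rewrite !mulr0.
have [j nz_nj] := mnm_neq0_exists _ nz_n.
have le_Un : (U_(j) <= n)%MM by rewrite lep1mP.
move: (submK le_Un) le_ne; set n' := (n - _)%MM => <-.
rewrite mdegD mdeg1 addn1 ltnS => lt_n'e.
rewrite mfactU mulnC natrM -mulrA [_.+1%:R * _]mulr_natl -mcoeff_mderiv mderiv_linsubst.
rewrite addmC mpolyXD rmorphM /= linsubstU /linform mulr_suml.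
rewrite !(linear_sum (mcoeff _)) !mulr_sumr; apply: eq_bigr => i _ /=.
rewrite mxE -scalerAl !mcoeffZ !(mulrCA _ (A i j)) mcoeffXM_fact.
rewrite mderivX linearZ /= mcoeffZ [(mfact n')%:R * _]mulrCA IHe //.
by rewrite natrM !mulrA.
Qed.

(** Entrywise this is [linsubst_reciprocity] multiplied by N! / (m! n!). *)
Lemma multinom_mx_sympow N A :
  multinom_mx C d N *m sympow N A = (sympow N A^T)^T *m multinom_mx C d N.
Proof.
apply/matrixP => k l; rewrite mul_diag_mx mul_mx_diag !mxE -!linsubstX.
rewrite -!natr_prod -!/(mfact _).
have := linsubst_reciprocity A (midx k) (midx l).
set a := _@__; set b := _@__ => eq_ab.
rewrite mulrAC [RHS]mulrA [b * _]mulrC; apply/eqP.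
rewrite eqr_div ?mfact_neq0 -?mulrA //.
by rewrite [a * _]mulrC eq_ab [b * _]mulrC.
Qed.

(** * Krawtchouk matrices *)

Lemma krawtchoukM N A B :
  krawtchouk N (A *m B) = krawtchouk N B *m krawtchouk N A.
Proof. by rewrite /krawtchouk sympowM trmx_mul map_mxM. Qed.

Lemma krawtchouk1 N : krawtchouk N 1%:M = 1%:M :> 'M[C]_#|multi_index d N|.
Proof. by rewrite /krawtchouk sympow1 trmx1 map_mx1. Qed.

(** For a diagonal matrix the symmetric power is diagonal as well, so the
transposition that separates the two sides in general does nothing. *)
Lemma krawtchouk_diag N (a : 'rV[C]_d.+1) :
  krawtchouk N (diag_mx a) = sympow N (diag_mx a ^t*).
Proof.
by rewrite /krawtchouk !tr_diag_mx sympow_conj sympow_diag tr_diag_mx.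
Qed.

Lemma krawtchouk_multinom_mx N A :
  krawtchouk N A *m multinom_mx C d N
    = multinom_mx C d N *m sympow N (A ^t*).
Proof.
by rewrite multinom_mx_sympow map_trmx trmxK sympow_conj map_trmx.
Qed.

Lemma trmxC_multinom_mx N : multinom_mx C d N ^t* = multinom_mx C d N.
Proof.
rewrite tr_diag_mx map_diag_mx; congr diag_mx; apply/rowP => k.
by rewrite !mxE -natr_prod fmorph_div !rmorph_nat.
Qed.

End SymmetricPower.

Lemma trmxC_mul (C : numClosedFieldType) m n p
    (A : 'M[C]_(m, n)) (B : 'M[C]_(n, p)) :
  (A *m B) ^t* = B ^t* *m A ^t*.
Proof. by rewrite trmx_mul map_mxM. Qed.

Lemma invmx_diag (F : fieldType) n (a : 'rV[F]_n) :
  (forall i, a 0 i != 0) ->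
  invmx (diag_mx a) = diag_mx (\row_i (a 0 i)^-1).
Proof.
move=> nz_a; have aV : diag_mx a *m diag_mx (\row_i (a 0 i)^-1) = 1%:M.
  rewrite mulmx_diag -diag_const_mx; congr diag_mx.
  by apply/rowP => i; rewrite !mxE divff.
have [a_unit _] := mulmx1_unit aV.
by rewrite -[LHS]mulmx1 -aV mulKmx.
Qed.

(** * Unitary reflections *)

Section UnitaryReflection.

Variables (C : numClosedFieldType) (n : nat).

Lemma sqnorm_cV_neq0 (v : 'cV[C]_n) : v != 0 -> (v ^t* *m v) 0 0 != 0.
Proof.
apply: contraNneq; rewrite mxE => /eqP.
rewrite psumr_eq0 => [/allP v0|i _]; last by rewrite !mxE mulrC mul_conjC_ge0.
apply/eqP/colP => i; have /implyP/(_ isT) := v0 i (mem_index_enum i).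
by rewrite !mxE mulrC mul_conjC_eq0 => /eqP.
Qed.

Lemma unitary_reflection_sqr (U : 'M[C]_n) :
  unitary_reflection U -> U *m U = 1%:M.
Proof.
case=> v nz_v ->; set c := (_ *m _) 0 0; set P := v *m _.
have nz_c : c != 0 by apply: sqnorm_cV_neq0.
have PP : P *m P = c *: P.
  rewrite /P mulmxA -[v *m _ *m v]mulmxA [_ *m v]mx11_scalar -/c.
  by rewrite mul_mx_scalar -scalemxAl.
rewrite mulmxBl mulmxBr mulmx1 mul1mx -scalemxAl -scalemxAr PP !scalerA.
rewrite -mulrA divfK // mulrDr mulr1 scalerDl addrK opprB addrC subrK //.
Qed.

Lemma unitary_reflection_trmxC (U : 'M[C]_n) :
  unitary_reflection U -> U ^t* = U.
Proof.
case=> v _ ->; set c := (_ *m _) 0 0.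
have c_real : c^* = c.
  rewrite /c !mxE rmorph_sum; apply: eq_bigr => i _ /=.
  by rewrite !mxE rmorphM /= conjCK mulrC.
rewrite linearB linearZ /= trmx1 map_mxB map_mx1 map_mxZ trmxC_mul trmxCK.
by rewrite fmorph_div rmorph_nat /= c_real.
Qed.

End UnitaryReflection.

(** * Krawtchouk matrices of unitary reflections *)

Section ReflectionKrawtchouk.

Variables (C : numClosedFieldType) (d N : nat) (U : 'M[C]_d.+1).
Variables (a s : 'rV[C]_d.+1).

Hypothesis U_refl : unitary_reflection U.
Hypothesis nz_a : forall i, a 0 i != 0.
Hypothesis s_gt0 : forall i, 0 < s 0 i.

Let delta := diag_mx a.
Let S := diag_mx s.
Let Phi := krawtchouk N (invmx delta *m U *m S).

Let S_unit : S \in unitmx.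
Proof.
by rewrite unitmxE det_diag unitfE; apply/prodf_neq0 => i _; rewrite gt_eqF.
Qed.

Let delta_unit : delta \in unitmx.
Proof. by rewrite unitmxE det_diag unitfE; apply/prodf_neq0. Qed.

Let S_herm : S ^t* = S.
Proof.
rewrite tr_diag_mx map_diag_mx; congr diag_mx; apply/rowP => i.
by rewrite !mxE /= conj_Creal // realE ltW.
Qed.

(** The matrix being squared is the Krawtchouk matrix of the involution
delta^-1 U delta. *)
Lemma krawtchouk_reflection_involutive :
  (sympow N (delta ^t* *m invmx S) *m Phi) ^+ 2 = 1%:M.
Proof.
have SVE : krawtchouk N (invmx S) = sympow N (invmx S).
  have SV_diag : invmx S = diag_mx (\row_i (s 0 i)^-1).
    by apply: invmx_diag => i; rewrite gt_eqF.
  have SV_herm : (invmx S) ^t* = invmx S by rewrite trmx_inv map_invmx S_herm.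
  by rewrite -[in RHS]SV_herm SV_diag krawtchouk_diag.
have -> : sympow N (delta ^t* *m invmx S) *m Phi
    = krawtchouk N (invmx delta *m U *m delta).
  rewrite sympowM -krawtchouk_diag -SVE -!krawtchoukM.
  by rewrite mulmxA mulmxK.
rewrite expr2 -[_ * _]/(_ *m _) -krawtchoukM.
rewrite !mulmxA mulmxK // -[_ *m U *m U]mulmxA unitary_reflection_sqr //.
by rewrite mulmx1 mulVmx // krawtchouk1.
Qed.

(** The matrix is B (sympow N H) for the Hermitian matrix H = S U S, and
(B (sympow N H))^* = Phi_H B = B (sympow N H^* ), with Phi_H the Krawtchouk
matrix of H. *)
Lemma krawtchouk_reflection_herm :
  let T := Phi *m multinom_mx C d N *m sympow N delta ^t* *m sympow N S in
  T ^t* = T.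
Proof.
have U_herm := unitary_reflection_trmxC _ _ _ U_refl.
pose H := S *m U *m S.
have H_herm : H ^t* = H by rewrite !trmxC_mul S_herm U_herm mulmxA.
have -> : Phi *m multinom_mx C d N *m sympow N delta ^t* *m sympow N S
    = multinom_mx C d N *m sympow N H.
  rewrite krawtchouk_multinom_mx -/(krawtchouk N delta) krawtchouk_diag.
  rewrite -!mulmxA -!sympowM.
  rewrite [_ ^t* *m (_ *m S)]mulmxA -trmxC_mul !mulmxA mulmxV // mul1mx.
  by rewrite trmxC_mul S_herm U_herm.
rewrite /= trmxC_mul trmxC_multinom_mx -/(krawtchouk N H).
by rewrite krawtchouk_multinom_mx H_herm.
Qed.

End ReflectionKrawtchouk.

Theorem proposition6p1 (R : realType) (d N : nat) (U D : 'M[R[i]]_d.+1)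
    (hU : unitary_reflection U)
    (hU0 : forall i : 'I_d.+1, U i 0 != 0)
    (hDdiag : is_diag_mx D)
    (hDpos : forall i : 'I_d.+1, 0 < D i i)
    (hD00 : D 0 0 = 1) :
  let delta := first_col_diag U in
  let A := invmx delta *m U *m sqrt_diag D in
  let Phi := krawtchouk N A in
  (sympow N (delta ^t* *m invmx (sqrt_diag D)) *m Phi) ^+ 2 = 1%:M
  /\ (let S := Phi *m multinom_mx R[i] d N *m (sympow N delta) ^t*
                 *m sympow N (sqrt_diag D) in
      S ^t* = S).
Proof.
have s_gt0 i : 0 < (\row_i sqrtC (D i i)) 0 i by rewrite mxE sqrtC_gt0.
have nz_a i : (\row_i U i 0) 0 i != 0 by rewrite mxE.
split; first exact: krawtchouk_reflection_involutive.
exact: krawtchouk_reflection_herm.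
Qed.
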